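(* Let $1\le c\le n-1$ and $-1\le\gamma<0$. For every connected graph $G$ of order $n$ with edge connectivity $1\le\kappa'(G)\le c$, \[{}^0R_{\gamma}(G)\ge c^{\gamma}+(n-c-1)(n-2)^{\gamma}+c(n-1)^{\gamma},\] with equality if and only if $G=K_c+(K_1\cup K_{n-c-1})$.
   Context: ${}^0R_{\gamma}(G)=\sum_{u\in V(G)} d(u)^{\gamma}$. Graphs are finite and simple. $\kappa'(G)$ is the largest $c$ such that $G$ has at least two vertices and no edge cut of size $c-1$. $G_1\cup G_2$ is the disjoint union, $G_1+G_2$ the join. $K_0$ is the empty graph. *)

(* Defs.v *)
From HB Require Import structures.
From mathcomp Require Import all_boot all_order all_algebra.
From mathcomp Require Import reals exp.

Set Implicit Arguments.
Unset Strict Implicit.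
Unset Printing Implicit Defensive.

Import Order.TTheory GRing.Theory Num.Theory.

Record sgraph := SGraph {
  vertex :> finType;
  adj : rel vertex;
  adj_sym : symmetric adj;
  adj_irrefl : irreflexive adj }.

Definition graph_order (G : sgraph) : nat := #|G|.

Definition degree (G : sgraph) (u : G) : nat := #|[set v : G | adj u v]|.

Definition graph_connected (G : sgraph) : Prop :=
  0 < graph_order G /\ forall x y : G, connect (@adj G) x y.

Definition edges (G : sgraph) : {set {set G}} :=
  [set E : {set G} | [exists x, exists y, adj x y && (E == [set x; y])]].

Section DeleteEdges.
Variables (G : sgraph) (F : {set {set G}}).

Definition delete_edges_adj : rel G :=
  [rel x y | adj x y && ([set x; y] \notin F)].

Fact delete_edges_sym : symmetric delete_edges_adj.
Proof. by move=> x y /=; rewrite /delete_edges_adj /= adj_sym setUC. Qed.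

Fact delete_edges_irrefl : irreflexive delete_edges_adj.
Proof. by move=> x; rewrite /delete_edges_adj /= adj_irrefl. Qed.

Definition delete_edges : sgraph :=
  SGraph delete_edges_sym delete_edges_irrefl.
End DeleteEdges.

Definition connectedb (G : sgraph) : bool :=
  (0 < graph_order G) && [forall x : G, forall y : G, connect (@adj G) x y].

Lemma connectedP (G : sgraph) : reflect (graph_connected G) (connectedb G).
Proof.
apply: (iffP andP) => -[G0 H]; split=> //.
  by move=> x y; move/forallP/(_ x)/forallP/(_ y): H.
by apply/forallP => x; apply/forallP => y.
Qed.

Definition edge_cut (G : sgraph) (F : {set {set G}}) : bool :=
  (F \subset edges G) && ~~ connectedb (delete_edges F).

Definition edge_connected (G : sgraph) (c : nat) : bool :=
  (1 < graph_order G) && [forall F : {set {set G}}, edge_cut F ==> (c <= #|F|)].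

(* The largest c such that G has at least two vertices and no edge cut of size
   at most c - 1; it is 0 if G has fewer than two vertices.  Deleting all the
   edges of a graph with at least two vertices disconnects it, so restricting c
   to the values up to #|edges G| loses nothing: see edge_connectivityP. *)
Definition edge_connectivity (G : sgraph) : nat :=
  \max_(c < #|edges G|.+1 | edge_connected G c) c.

Lemma edge_cut_edges (G : sgraph) : 1 < graph_order G -> edge_cut (edges G).
Proof.
move=> G1; rewrite /edge_cut subxx /=; apply/negP => /connectedP[_ H].
have /card_gt1P[x [y [_ _ xy]]] : 1 < #|[set: G]| by rewrite cardsT.
have /connectP[[|z p] /= + E] := H x y; first by rewrite E eqxx in xy.
case/andP=> /andP[xz]; rewrite inE => /negP[].
by apply/existsP; exists x; apply/existsP; exists z; rewrite xz eqxx.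
Qed.

Lemma edge_connectivityP (G : sgraph) (c : nat) : 1 < graph_order G ->
  edge_connected G c = (c <= edge_connectivity G).
Proof.
move=> G1; have c_le k : edge_connected G k -> k < #|edges G|.+1.
  by case/andP=> _ /forallP/(_ (edges G)); rewrite edge_cut_edges.
apply/idP/idP => [Gc|c_le_k].
  exact: (@leq_bigmax_cond _ _ (fun i : 'I__ => i : nat) (Ordinal (c_le _ Gc))).
have G0 : edge_connected G 0.
  by rewrite /edge_connected G1; apply/forallP => F; apply/implyP.
have [i Gi Ei] : {i : 'I_#|edges G|.+1 | edge_connected G i
                   & edge_connectivity G = i}.
  by apply: eq_bigmax_cond; apply/card_gt0P; exists ord0.
case/andP: Gi => _ /forallP H; rewrite /edge_connected G1.
apply/forallP => F; apply/implyP => cutF; apply: (leq_trans c_le_k).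
by rewrite Ei; apply: (implyP (H F)).
Qed.

Section Complete.
Variable n : nat.
Definition complete_adj : rel 'I_n := [rel x y | x != y].
Fact complete_sym : symmetric complete_adj.
Proof. by move=> x y; rewrite /complete_adj /= eq_sym. Qed.
Fact complete_irrefl : irreflexive complete_adj.
Proof. by move=> x; rewrite /complete_adj /= eqxx. Qed.
Definition complete_graph : sgraph := SGraph complete_sym complete_irrefl.
End Complete.

Section UnionJoin.
Variables G H : sgraph.

Definition union_adj : rel (G + H) := fun u v =>
  match u, v with
  | inl x, inl y => adj x y
  | inr x, inr y => adj x y
  | _, _ => false
  end.
Fact union_sym : symmetric union_adj.
Proof. by move=> [x|x] [y|y] //=; apply: adj_sym. Qed.
Fact union_irrefl : irreflexive union_adj.
Proof. by move=> [x|x] /=; apply: adj_irrefl. Qed.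
Definition graph_union : sgraph := SGraph union_sym union_irrefl.

Definition join_adj : rel (G + H) := fun u v =>
  match u, v with
  | inl x, inl y => adj x y
  | inr x, inr y => adj x y
  | _, _ => true
  end.
Fact join_sym : symmetric join_adj.
Proof. by move=> [x|x] [y|y] //=; apply: adj_sym. Qed.
Fact join_irrefl : irreflexive join_adj.
Proof. by move=> [x|x] /=; apply: adj_irrefl. Qed.
Definition graph_join : sgraph := SGraph join_sym join_irrefl.
End UnionJoin.

Definition graph_iso (G H : sgraph) : Prop :=
  exists f : G -> H, bijective f /\ forall x y : G, adj (f x) (f y) = adj x y.

Local Open Scope ring_scope.

Definition zeroth_randic (R : realType) (gamma : R) (G : sgraph) : R :=
  \sum_(u : G) (degree u)%:R `^ gamma.

(* Main.v *)
(** An edge cut of size at most [c] splits the vertices into two nonempty classes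
    [A] and [~: A] joined by at most [c] edges.

    If some vertex [v] has degree at most [c], its neighbours have degree at most
    [n - 1] and all other vertices have degree at most [n - 2]; since [x `^ gamma]
    is decreasing this gives the bound, with equality exactly when [v] has degree
    [c] and all the other degree bounds are attained.

    If all degrees exceed [c], counting degrees in [A] and [~: A] shows that both
    classes have at least [c + 2] vertices, and the inequality is strict.  It is
    enough to see this for [gamma = -1]: as [x `^ gamma] is a concave function of
    [x^-1], comparing slopes at the minimum degree transfers the inequality to
    [gamma].  For [gamma = -1] the tangent of [x^-1] at [a = #|A|] yields
    [\sum_(u in A) (degree u)^-1 >= 1 + (a - c) / a ^ 2], likewise for [~: A],
    and the sum of the two beats the bound. *)
Require Import Defs.
From HB Require Import structures.
From mathcomp Require Import all_boot all_order all_algebra.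
From mathcomp Require Import reals exp.
From mathcomp Require Import lra ring zify.

Set Implicit Arguments.
Unset Strict Implicit.
Unset Printing Implicit Defensive.

Import Order.TTheory GRing.Theory Num.Theory.

Local Open Scope ring_scope.

(** * Real powers with a negative exponent *)

Section PowR.
Variable R : realType.
Implicit Types x y s t g : R.

Lemma powR_bernoulli s t : 0 < s -> 0 < t <= 1 -> s `^ t <= 1 + t * (s - 1).
Proof.
move=> s0 /andP[t0 t1]; have [->|tN1] := eqVneq t 1.
  by rewrite powRr1 ?(ltW s0)//; lra.
have q0 : 0 < 1 - t by rewrite subr_gt0 lt_neqAle tN1.
have := @conjugate_powR R (s `^ t) 1 t^-1 (1 - t)^-1 (powR_ge0 _ _) ler01.
rewrite !invr_gt0 t0 q0 !invrK subrKC => /(_ isT isT erefl).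
by rewrite -powRrM mulfV ?gt_eqF// powRr1 ?(ltW s0)// powR1 mulr1; lra.
Qed.

Lemma lt0_ltr_powR g x y : g < 0 -> 0 < x -> x < y -> y `^ g < x `^ g.
Proof.
move=> g0 x0 xy; have y0 := lt_trans x0 xy.
rewrite -[g]opprK !(powRN _ (- g)) ltf_pV2 ?posrE ?powR_gt0//.
by apply: gt0_ltr_powR; rewrite ?oppr_gt0 ?nnegrE ?ltW.
Qed.

Lemma lt0_ler_powR g x y : g < 0 -> 0 < x -> x <= y -> y `^ g <= x `^ g.
Proof.
move=> g0 x0; rewrite le_eqVlt => /predU1P[->//|xy].
exact/ltW/lt0_ltr_powR.
Qed.

(* [x `^ g] is a concave function of [x^-1]. *)
Lemma powR_tangent_inv g x y : -1 <= g < 0 -> 0 < x -> 0 < y ->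
  y `^ g <= x `^ g + - g * x `^ (g + 1) * (y^-1 - x^-1).
Proof.
move=> /andP[g1 g0] x0 y0.
have xy0 : 0 < x / y by rewrite divr_gt0.
have K : 0 < - g <= 1 by apply/andP; split; lra.
have yV : y^-1 `^ (- g) = y `^ g.
  by rewrite -powR_inv1 ?(ltW y0)// -powRrM mulN1r opprK.
have xV : x `^ (g + 1) = x `^ g * x.
  by rewrite powRD ?powRr1 ?(ltW x0) ?(gt_eqF x0) ?implybT.
have yE : y `^ g = x `^ g * (x / y) `^ (- g).
  rewrite powRM ?invr_ge0 ?(ltW x0) ?(ltW y0)// yV mulrA -powRD.
    by rewrite subrr powRr0 mul1r.
  by rewrite subrr eqxx gt_eqF.
rewrite yE xV.
apply: le_trans (ler_wpM2l (powR_ge0 x g) (powR_bernoulli xy0 K)) _.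
rewrite le_eqVlt; apply/orP; left; apply/eqP.
by field; rewrite !gt_eqF.
Qed.

Lemma powR_diff_inv g z x y : -1 <= g < 0 -> 0 < z -> z <= x -> x <= y ->
  - g * z `^ (g + 1) * (x^-1 - y^-1) <= x `^ g - y `^ g.
Proof.
move=> hg z0 zx xy; have x0 := lt_le_trans z0 zx; have y0 := lt_le_trans x0 xy.
have T := powR_tangent_inv hg x0 y0; case/andP: hg => g1 g0.
have D : 0 <= x^-1 - y^-1 by rewrite subr_ge0 lef_pV2 ?posrE.
have Z : z `^ (g + 1) <= x `^ (g + 1).
  by apply: ge0_ler_powR; rewrite ?nnegrE ?(ltW z0) ?(ltW x0)//; lra.
have : - g * z `^ (g + 1) * (x^-1 - y^-1) <= - g * x `^ (g + 1) * (x^-1 - y^-1).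
  by apply: ler_wpM2r => //; apply: ler_wpM2l => //; lra.
lra.
Qed.

(* Passing from [x `^ g] to [x^-1] in a comparison of two sums is harmless when
   the differences of the two families change sign only at the least member
   [d v] of the larger one. *)
Lemma sum_powR_gt (T : finType) (d : T -> R) (v : T) (g c M N : R) (k : nat) :
  -1 <= g < 0 -> 0 < c -> 0 < d v -> (forall u, d v <= d u <= M) -> M <= N ->
  c^-1 + (#|T|%:R - k%:R - 1) * M^-1 + k%:R * N^-1 < \sum_u (d u)^-1 ->
  c `^ g + (#|T|%:R - k%:R - 1) * M `^ g + k%:R * N `^ g < \sum_u (d u) `^ g.
Proof.
move=> hg c0 v0 dM MN; have /andP[_ vM] := dM v.
set q := - g * d v `^ (g + 1).
have q0 : 0 < q by rewrite mulr_gt0 ?powR_gt0//; case/andP: hg => _ ?; lra.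
have Hc : c `^ g <= d v `^ g + q * (c^-1 - (d v)^-1) := powR_tangent_inv hg v0 c0.
have HN : k%:R * (q * (M^-1 - N^-1)) <= k%:R * (M `^ g - N `^ g).
  by apply: ler_wpM2l => //; exact: powR_diff_inv.
have HM : \sum_(u | u != v) (q * ((d u)^-1 - M^-1) + M `^ g)
          <= \sum_(u | u != v) d u `^ g.
  apply: ler_sum => u _; have /andP[vu uM] := dM u.
  by rewrite -lerBrDr; exact: powR_diff_inv.
have cT : (#|T| = #|[pred u | u != v]|.+1)%N.
  rewrite (cardD1 v) add1n; congr _.+1.
  by apply: eq_card => u; rewrite !inE andbT.
rewrite big_split /= -mulr_sumr big_split /= !sumr_const in HM.
rewrite (bigD1 v)//= => S; rewrite [ltRHS](bigD1 v)//=.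
move: S HM; set s := \sum_(_ | _) _; set s' := \sum_(_ | _) _.
rewrite cT -[in X in X -> _]natr1 -natr1.
rewrite -(mulr_natr (- _)) -(mulr_natr (M `^ g)); set m := _%:R => S HM.
(* Multiplied by the common slope [q], the hypothesis combines linearly with the slope estimates. *)
rewrite -subr_gt0 -(pmulr_rgt0 _ q0) in S.
clear -S HM HN Hc; move: S HM HN Hc.
move: (c `^ g) (d v `^ g) (M `^ g) (N `^ g) (c^-1) (d v)^-1 M^-1 N^-1 q.
move: s s' m k%:R => s s' m l cg vg Mg Ng ci vi Mi Ni q S HM HN Hc.
lra.
Qed.

End PowR.

(** * Degrees, edge boundaries and edge connectivity *)

Section Degree.
Variable G : sgraph.
Implicit Types (u v w : G) (A : {set G}).

Lemma degreeE u : degree u = (\sum_v adj u v)%N.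
Proof.
by rewrite /degree -sum1dep_card big_mkcond; apply: eq_bigr => v _; case: adj.
Qed.

Lemma degree_lt_order u : (degree u < #|G|)%N.
Proof.
rewrite -cardsT; apply: proper_card; apply/properP; split; first exact: subsetT.
by exists u; rewrite !inE ?adj_irrefl.
Qed.

Lemma degree_gt0 u : graph_connected G -> (1 < #|G|)%N -> (0 < degree u)%N.
Proof.
case=> _ conn; rewrite (cardD1 u) ltnS => /card_gt0P[w]; rewrite !inE andbT => wu.
have /connectP[[|z p] /= + E] := conn u w; first by rewrite E eqxx in wu.
by case/andP=> uz _; apply/card_gt0P; exists z; rewrite inE.
Qed.

Lemma adj_degree_max u w : #|G| = (degree u).+1 -> w != u -> adj u w.
Proof.
move=> dE wu; apply: contraT => uw.
suff : ([set v | adj u v] \subset ~: [set u; w]).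
  move/subset_leq_card; have := cardsC [set u; w].
  by rewrite cards2 eq_sym wu dE /degree; lia.
apply/subsetP => v; rewrite !inE => uv; apply/norP; split.
  by apply: contraTneq uv => ->; rewrite adj_irrefl.
by apply: contraTneq uv => ->.
Qed.

Lemma degree_nonadj u v : v != u -> ~~ adj v u -> (degree u + 1 < #|G|)%N.
Proof.
move=> vu nvu; rewrite ltnNge; apply: contra nvu => le.
by rewrite adj_sym adj_degree_max//; have := degree_lt_order u; lia.
Qed.

Lemma adj_degree_submax u v w : #|G| = (degree u).+2 -> v != u -> ~~ adj v u ->
  w != u -> w != v -> adj u w.
Proof.
move=> dE vu nvu wu wv; apply: contraT => uw.
suff : ([set v | adj u v] \subset ~: (v |: [set u; w])).
  move/subset_leq_card; have := cardsC (v |: [set u; w]).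
  rewrite cardsU1 cards2 !inE (negPf vu) [v == w]eq_sym (negPf wv).
  by rewrite [u == w]eq_sym wu dE /degree; lia.
apply/subsetP => x; rewrite !inE => ux; apply/norP; split.
  by apply: contraTneq ux => ->; rewrite adj_sym.
apply/norP; split; last by apply: contraTneq ux => ->.
by apply: contraTneq ux => ->; rewrite adj_irrefl.
Qed.

(** Crossing edges are oriented out of [A]: each appears once, and grouping by first coordinate
    counts them by their endpoint in [A]. *)
Definition boundary A : {set G * G} :=
  [set p | [&& p.1 \in A, p.2 \notin A & adj p.1 p.2]].

Lemma card_boundaryC A : #|boundary (~: A)| = #|boundary A|.
Proof.
have swap_inj : injective (fun p : G * G => (p.2, p.1)).
  by move=> [u v] [u' v'] [-> ->].
rewrite -(card_imset _ swap_inj); apply: eq_card => -[u v].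
apply/imsetP/idP => [[[x y]]|].
  by rewrite !inE /= negbK adj_sym => /and3P[xA yA xy] [-> ->]; rewrite yA xA.
rewrite inE /= => /and3P[uA vA uv]; exists (v, u) => //.
by rewrite !inE /= negbK uA vA adj_sym.
Qed.

Lemma card_boundaryE A :
  #|boundary A| = (\sum_(u in A) #|[set v | adj u v] :\: A|)%N.
Proof.
rewrite -sum1_card; under [RHS]eq_bigr => u _ do rewrite -sum1_card.
rewrite pair_big_dep /=; apply: eq_bigl => -[u v] /=.
by rewrite !inE.
Qed.

Lemma degree_boundary A u : u \in A ->
  (degree u <= #|A|.-1 + #|[set v | adj u v] :\: A|)%N.
Proof.
move=> uA; rewrite /degree -(cardsID A) leq_add2r.
rewrite (cardsD1 u A) uA /=; apply: subset_leq_card; apply/subsetP => v.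
rewrite !inE => /andP[uv ->]; rewrite andbT.
by apply: contraTneq uv => ->; rewrite adj_irrefl.
Qed.

Lemma degree_le_boundary A u : u \in A -> (degree u <= #|A|.-1 + #|boundary A|)%N.
Proof.
move=> uA; apply: leq_trans (degree_boundary uA) _.
by rewrite leq_add2l card_boundaryE (bigD1 u)//= leq_addr.
Qed.

Lemma sum_degree_boundary A :
  (\sum_(u in A) degree u <= #|A| * #|A|.-1 + #|boundary A|)%N.
Proof.
rewrite card_boundaryE -sum_nat_const -big_split /=.
by apply: leq_sum => u; exact: degree_boundary.
Qed.

Lemma edge_connectivity_boundary : (1 < #|G|)%N ->
  exists A, [/\ A != set0, ~: A != set0 & (#|boundary A| <= edge_connectivity G)%N].
Proof.
move=> G1; have := edge_connectivityP (edge_connectivity G).+1 G1.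
rewrite ltnn /edge_connected /graph_order G1 /= => /forallPn[F].
rewrite negb_imply -ltnNge ltnS => /andP[/andP[FE]].
rewrite negb_and -leqNgt => /orP[|]; first by rewrite leqn0 eqn0Ngt (ltnW G1).
move=> /forallPn[x /forallPn[y xy]] Fc.
(* [A] is the component of [x] once the cut [F] is deleted; it misses [y]. *)
pose A : {set G} := [set z : G | connect (@adj (delete_edges F)) x z].
exists A; split.
- by apply/set0Pn; exists x; rewrite inE connect0.
- by apply/set0Pn; exists y; rewrite !inE.
apply: leq_trans Fc.
(* An unordered crossing edge recovers its orientation, since exactly one end lies in [A]. *)
have inj : {in boundary A &, injective (fun p : G * G => [set p.1; p.2])}.
  move=> [u v] [u' v']; rewrite [(u, v) \in _]inE [(u', v') \in _]inE /=.
  move=> /and3P[uA vA _] /and3P[u'A v'A _] E.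
  have : u \in [set u'; v'] by rewrite -E set21.
  rewrite in_set2 => /orP[/eqP uE|/eqP uE]; last by rewrite -uE uA in v'A.
  have : v \in [set u'; v'] by rewrite -E set22.
  by rewrite in_set2 => /orP[/eqP vE|/eqP ->]; [rewrite vE u'A in vA | rewrite uE].
rewrite -(card_in_imset inj); apply: subset_leq_card.
apply/subsetP => _ /imsetP[[u v] + ->]; rewrite inE /= => /and3P[uA vA uv].
apply: contraR vA => uvF; move: uA; rewrite !inE => uA.
apply: (connect_trans uA); apply: connect1.
by rewrite /= /delete_edges_adj /= uv.
Qed.

End Degree.

(** * The extremal graph: its degrees, its index and a characterisation *)

Lemma degree_join_inl (G H : sgraph) (x : G) :
  degree (inl x : graph_join G H) = (degree x + #|H|)%N.
Proof. by rewrite !degreeE big_sumType /= sum1_card. Qed.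

Lemma degree_join_inr (G H : sgraph) (x : H) :
  degree (inr x : graph_join G H) = (#|G| + degree x)%N.
Proof. by rewrite !degreeE big_sumType /= sum1_card. Qed.

Lemma degree_union_inl (G H : sgraph) (x : G) :
  degree (inl x : graph_union G H) = degree x.
Proof. by rewrite !degreeE big_sumType /= big1_eq addn0. Qed.

Lemma degree_union_inr (G H : sgraph) (x : H) :
  degree (inr x : graph_union G H) = degree x.
Proof. by rewrite !degreeE big_sumType /= big1_eq. Qed.

Lemma degree_complete n (x : complete_graph n) : degree x = n.-1.
Proof.
rewrite /degree -[in RHS](card_ord n) -(cardsC1 x); apply: eq_card => y.
by rewrite !inE eq_sym.
Qed.

Lemma degree_iso (G H : sgraph) (f : G -> H) (x : G) : bijective f ->
  (forall x y, adj (f x) (f y) = adj x y) -> degree (f x) = degree x.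
Proof.
move=> fb fadj; rewrite !degreeE (reindex f) /=; last exact: onW_bij.
by apply: eq_bigr => y _; rewrite fadj.
Qed.

Lemma zeroth_randic_iso (R : realType) (g : R) (G H : sgraph) :
  graph_iso G H -> zeroth_randic g G = zeroth_randic g H.
Proof.
case=> f [fb fadj]; rewrite /zeroth_randic [RHS](reindex f) /=; last exact: onW_bij.
by apply: eq_bigr => x _; rewrite (degree_iso x fb fadj).
Qed.

Definition extremal_graph n c :=
  graph_join (complete_graph c)
             (graph_union (complete_graph 1) (complete_graph (n - c - 1))).

Lemma zeroth_randic_extremal (R : realType) (g : R) (n c : nat) :
  (1 <= c <= n - 1)%N ->
  zeroth_randic g (extremal_graph n c) =
  c%:R `^ g + (n - c - 1)%:R * (n - 2)%:R `^ g + c%:R * (n - 1)%:R `^ g.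
Proof.
move=> hc; rewrite /zeroth_randic !big_sumType /= big_ord_recl big_ord0 addr0.
rewrite degree_join_inr degree_union_inl degree_complete card_ord addn0.
under eq_bigr => i _ do rewrite degree_join_inl degree_complete card_sum !card_ord.
under [X in _ + (_ + X)]eq_bigr => i _ do
  rewrite degree_join_inr degree_union_inr degree_complete card_ord.
rewrite !sumr_const !card_ord !mulr_natl addrC; congr (_ + _ + _ `^ _ *+ _).
  (* If the last clique is empty, the truncated predecessor gives a degree other than [n - 2], but
     the term has multiplicity zero. *)
  have [->|m0] := posnP (n - c - 1); first by rewrite !mulr0n.
  by congr (_%:R `^ _ *+ _); lia.
by congr _%:R; lia.
Qed.

(** The adjacency conditions determine [G]: the neighbours of [v] form [K_c], [v] is the [K_1], and
    the remaining vertices form the other clique. *)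
Lemma extremal_iso (G : sgraph) (n c : nat) (v : G) : (1 <= c <= n - 1)%N ->
  #|G| = n -> degree v = c ->
  (forall u w, adj v u -> w != u -> adj u w) ->
  (forall u w, u != v -> ~~ adj v u -> w != u -> w != v -> adj u w) ->
  graph_iso G (extremal_graph n c).
Proof.
move=> hc Gn vc adjN adjM.
pose N := [set u | adj v u]; pose M := ~: (v |: N).
have vN : v \notin N by rewrite inE adj_irrefl.
have cN : c = #|N| by rewrite -vc.
have cM : (n - c - 1)%N = #|M|.
  by have := cardsC (v |: N); rewrite cardsU1 vN -/M Gn -cN; lia.
pose h (x : extremal_graph n c) : G :=
  match x with
  | inl i => enum_val (cast_ord cN i)
  | inr (inl _) => v
  | inr (inr j) => enum_val (cast_ord cM j)
  end.
have hN i : h (inl i) \in N by exact: enum_valP.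
have hM j : h (inr (inr j)) \in M by exact: enum_valP.
have Mv u : u \in M -> (u != v) && (u \notin N) by rewrite in_setC in_setU1 negb_or.
have hinj : injective h.
  move=> [i|[i|i]] [j|[j|j]] E.
  - by congr inl; exact: cast_ord_inj (enum_val_inj E).
  - by have := hN i; rewrite E (negPf vN).
  - by have := Mv _ (hM j); rewrite -E hN andbF.
  - by have := hN j; rewrite -E (negPf vN).
  - by congr (inr (inl _)); rewrite !ord1.
  - by have := Mv _ (hM j); rewrite -E eqxx.
  - by have := Mv _ (hM i); rewrite E hN andbF.
  - by have := Mv _ (hM i); rewrite E eqxx.
  - by congr (inr (inr _)); exact: cast_ord_inj (enum_val_inj E).
have hbij : bijective h.
  by apply: inj_card_bij => //; rewrite !card_sum !card_ord Gn; lia.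
have hadj x y : adj (h x) (h y) = adj x y.
  have [->|xy] := eqVneq x y; first by rewrite !adj_irrefl.
  have hyx : h y != h x by rewrite (inj_eq hinj) eq_sym.
  have hNa i z : z != inl i -> adj (h (inl i)) (h z).
    move=> zi; apply: adjN; first by have := hN i; rewrite inE.
    by rewrite (inj_eq hinj).
  have hMv j : adj v (h (inr (inr j))) = false.
    by have := Mv _ (hM j); rewrite inE => /andP[_ /negPf].
  move: x y xy hyx => [i|x] [j|y] xy hyx.
  - by rewrite hNa ?[inl j == _]eq_sym.
  - by rewrite hNa.
  - by rewrite adj_sym hNa.
  - move: x y xy hyx => [x|x] [y|y] xy hyx.
    + by rewrite !ord1 eqxx in xy.
    + exact: hMv.
    + by rewrite adj_sym; exact: hMv.
    + have /andP[xv xN] := Mv _ (hM x); have /andP[yv _] := Mv _ (hM y).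
      by rewrite adjM// hMv.
case: (hbij) => f hf fh; exists f; split; first exact: (Bijective fh hf).
by move=> x y; rewrite -hadj !fh.
Qed.

(** * The bound, by whether some degree is at most [c] *)

Section Bound.
Variable R : realType.
Implicit Types (g : R) (G : sgraph).

(** The [leif] form carries the equality case through sums. *)
Lemma leif_powR_nat g x y : g < 0 -> (0 < x <= y)%N ->
  y%:R `^ g <= x%:R `^ g ?= iff (x == y).
Proof.
move=> g0 /andP[x0 xy]; have [<-|xNy] := eqVneq x y; first exact: leif_refl.
have lt : y%:R `^ g < x%:R `^ g.
  by apply: lt0_ltr_powR => //; rewrite ?ltr0n// ltr_nat ltn_neqAle xNy.
by split; [exact: ltW|rewrite lt_eqF].
Qed.

Lemma zeroth_randic_low_degree g G n c (v : G) : g < 0 -> (1 <= c <= n - 1)%N ->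
  graph_connected G -> #|G| = n -> (degree v <= c)%N ->
  let bound := c%:R `^ g + (n - c - 1)%:R * (n - 2)%:R `^ g
               + c%:R * (n - 1)%:R `^ g in
  bound <= zeroth_randic g G /\
  (zeroth_randic g G = bound -> graph_iso G (extremal_graph n c)).
Proof.
move=> g0 hc conn Gn vc bound.
have dpos (u : G) : (0 < degree u)%N by apply: degree_gt0; rewrite ?Gn//; lia.
pose top u := if adj v u then (n - 1)%N else (n - 2)%N.
have top_le u : u != v -> (0 < degree u <= top u)%N.
  move=> uv; rewrite dpos /top /=; have := degree_lt_order u; rewrite Gn.
  case: ifPn => [_|nvu]; first by lia.
  have vu : v != u by rewrite eq_sym.
  by have := degree_nonadj vu nvu; rewrite Gn; lia.
have /= [le_top eq_top] := leif_sum (fun u uv => leif_powR_nat g0 (top_le u uv)).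
have top_sum : \sum_(u | u != v) (top u)%:R `^ g =
    (degree v)%:R * (n - 1)%:R `^ g + (n - degree v - 1)%:R * (n - 2)%:R `^ g.
  rewrite (bigID (adj v)) /= (eq_bigr (fun=> (n - 1)%:R `^ g)); last first.
    by move=> u /andP[_ vu]; rewrite /top vu.
  rewrite [X in _ + X](eq_bigr (fun=> (n - 2)%:R `^ g)); last first.
    by move=> u /andP[_ /negPf vu]; rewrite /top vu.
  pose N := [set u | adj v u]; have vN : v \notin N by rewrite inE adj_irrefl.
  rewrite (eq_bigl (mem N)) => [|u]; last first.
    by rewrite !inE; case: eqVneq => // ->; rewrite adj_irrefl.
  rewrite [X in _ + X](eq_bigl (mem (~: (v |: N)))) => [|u]; last first.
    by rewrite !inE negb_or.
  rewrite !sumr_const !mulr_natl; congr (_ + _ *+ _).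
  by have := cardsC (v |: N); rewrite cardsU1 vN Gn /degree -/N; lia.
have [le_vc eq_vc] : c%:R `^ g <= (degree v)%:R `^ g ?= iff (degree v == c).
  by apply: leif_powR_nat => //; rewrite dpos.
have le_cd : 0 <= (c - degree v)%:R * ((n - 2)%:R `^ g - (n - 1)%:R `^ g).
  (* When [degree v = c], [n - 2] may be 0, where monotonicity of the power fails. Otherwise
     [0 < degree v < c <= n - 1] makes it positive. *)
  have [->|] := posnP (c - degree v); first by rewrite mul0r.
  move=> cd; rewrite mulr_ge0// subr_ge0; apply: lt0_ler_powR => //.
    by rewrite ltr0n; have := dpos v; lia.
  by rewrite ler_nat; lia.
have split_bound : bound + (c - degree v)%:R * ((n - 2)%:R `^ g - (n - 1)%:R `^ g)
    = c%:R `^ g + \sum_(u | u != v) (top u)%:R `^ g.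
  rewrite top_sum /bound.
  have -> : (n - degree v - 1 = (n - c - 1) + (c - degree v))%N by lia.
  have -> : c%:R = (degree v)%:R + (c - degree v)%:R :> R by rewrite -natrD subnKC.
  by rewrite natrD; ring.
have ZE : zeroth_randic g G
    = (degree v)%:R `^ g + \sum_(u | u != v) (degree u)%:R `^ g.
  by rewrite /zeroth_randic (bigD1 v).
split=> [|Zb]; first by rewrite ZE; lra.
(* The excess over [bound] is the sum of the nonnegative gaps in [le_vc], [le_top] and [le_cd], so
   equality closes each of them. *)
have dv : degree v = c by apply/eqP; rewrite -eq_vc; apply/eqP; lra.
have /forall_inP dtop : [forall (u | u != v), degree u == top u].
  by rewrite -eq_top; apply/eqP; lra.
apply: (extremal_iso hc Gn dv) => [u w vu wu|u w uv nvu wu wv].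
  apply: adj_degree_max => //.
  have uv : u != v by apply: contraTneq vu => ->; rewrite adj_irrefl.
  by have := dtop u uv; rewrite /top vu => /eqP ->; rewrite Gn; lia.
apply: (@adj_degree_submax _ u v); rewrite // 1?eq_sym//.
have /eqP := dtop u uv; rewrite /top (negPf nvu) Gn => dE.
by have := dpos u; lia.
Qed.

Lemma sum_inv_degree G (A : {set G}) c : (forall u : G, 0 < degree u)%N ->
  (0 < #|A|)%N -> (#|boundary A| <= c)%N ->
  1 + (#|A|%:R - c%:R) / #|A|%:R ^+ 2 <= \sum_(u in A) (degree u)%:R^-1 :> R.
Proof.
move=> dpos A0 bc; set a : R := #|A|%:R.
have a0 : 0 < a by rewrite ltr0n.
have sum_le : \sum_(u in A) (degree u)%:R <= a * (a - 1) + c%:R.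
  rewrite -natr_sum.
  have -> : a * (a - 1) + c%:R = (#|A| * #|A|.-1 + c)%:R.
    by rewrite natrD natrM -subn1 natrB.
  rewrite ler_nat; apply: leq_trans (sum_degree_boundary A) _.
  by rewrite leq_add2l.
(* The tangent to [x^-1] at [x = a]. *)
have tangent (u : G) : u \in A -> 2 / a - (degree u)%:R / a ^+ 2 <= (degree u)%:R^-1.
  move=> _; set d : R := (degree u)%:R; have d0 : 0 < d by rewrite ltr0n.
  have -> : d^-1 = 2 / a - d / a ^+ 2 + (a - d) ^+ 2 / (d * a ^+ 2).
    by field; rewrite !gt_eqF.
  by rewrite lerDl divr_ge0 ?sqr_ge0// mulr_ge0 ?sqr_ge0// ltW.
apply: le_trans (ler_sum _ tangent); rewrite big_split /= sumr_const.
rewrite -(mulr_natr (2 / a)) -/a sumrN -mulr_suml.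
have : (\sum_(u in A) (degree u)%:R) / a ^+ 2 <= (a * (a - 1) + c%:R) / a ^+ 2.
  by rewrite ler_pM2r// invr_gt0 exprn_gt0.
suff -> : 1 + (a - c%:R) / a ^+ 2 = 2 / a * a - (a * (a - 1) + c%:R) / a ^+ 2 by lra.
by field; rewrite gt_eqF.
Qed.

Lemma inv_bound (a b c : nat) : (0 < c)%N -> (c + 2 <= a)%N -> (c + 2 <= b)%N ->
  c%:R^-1 + ((a + b)%:R - c%:R - 1) * (a + b - 2)%:R^-1 + c%:R * (a + b - 1)%:R^-1
  < 1 + (a%:R - c%:R) / a%:R ^+ 2 + (1 + (b%:R - c%:R) / b%:R ^+ 2) :> R.
Proof.
move=> c0 ca cb.
have -> : (a + b - 2)%:R = a%:R + b%:R - 2 :> R by rewrite natrB ?natrD//; lia.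
have -> : (a + b - 1)%:R = a%:R + b%:R - 1 :> R by rewrite natrB ?natrD//; lia.
have pos (k : nat) : (c + 2 <= k)%N -> 0 < (k%:R - c%:R) / k%:R ^+ 2 :> R.
  by move=> ck; rewrite divr_gt0 ?exprn_gt0 ?ltr0n ?subr_gt0 ?ltr_nat//; lia.
have pa := pos a ca; have pb := pos b cb.
rewrite natrD; have cR : 1 <= c%:R :> R by rewrite ler1n.
have caR : c%:R + 2 <= a%:R :> R by rewrite -natrD ler_nat.
have cbR : c%:R + 2 <= b%:R :> R by rewrite -natrD ler_nat.
(* For [c = 1] the left side is [2 + (a + b - 1)^-1], whose last term is absorbed by
   [(a - 1) / a ^ 2]; the term in [b] gives strictness. For [c >= 2] the left side is at most 2, as
   [c^-1] and [(a + b - 1)^-1] are each at most 1/2. *)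
have [c1|c2] : c = 1 \/ (2 <= c)%N by lia.
  rewrite c1 in pb caR cbR *; move: a%:R b%:R caR cbR pb => {a b ca cb pa pos} a b.
  move=> ha hb pb.
  have -> : (a + b - 1%:R - 1) / (a + b - 2) = 1.
    by rewrite (_ : a + b - 1%:R - 1 = a + b - 2) ?mulfV ?gt_eqF//; lra.
  have le1 : (a + b - 1)^-1 <= (a + 2)^-1 by rewrite lef_pV2 ?posrE; lra.
  have le2 : (a + 2)^-1 <= (a - 1%:R) / a ^+ 2.
    rewrite -[_^-1]div1r ler_pdivrMr; last by lra.
    by rewrite mulrAC ler_pdivlMr ?exprn_gt0//; nra.
  by rewrite invr1 mul1r; lra.
have c2R : 2 <= c%:R :> R by rewrite (ler_nat R 2).
move: a%:R b%:R c%:R caR cbR pa pb c2R => {a b c c0 ca cb pos cR c2} a b c.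
move=> ha hb pa pb c2.
have E : (a + b - c - 1) / (a + b - 2) = 1 - (c - 1) / (a + b - 2).
  by field; rewrite gt_eqF//; lra.
have F : c / (a + b - 1) = (c - 1) / (a + b - 1) + (a + b - 1)^-1 by ring.
have G : (c - 1) / (a + b - 1) <= (c - 1) / (a + b - 2).
  by rewrite ler_wpM2l ?lef_pV2 ?posrE; lra.
have H : c^-1 <= 2^-1 by rewrite lef_pV2 ?posrE; lra.
have K : (a + b - 1)^-1 <= 2^-1 by rewrite lef_pV2 ?posrE; lra.
lra.
Qed.

Lemma zeroth_randic_high_degree g G n c : -1 <= g < 0 -> (1 <= c <= n - 1)%N ->
  #|G| = n -> (edge_connectivity G <= c)%N -> (forall u : G, c < degree u)%N ->
  c%:R `^ g + (n - c - 1)%:R * (n - 2)%:R `^ g + c%:R * (n - 1)%:R `^ g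
  < zeroth_randic g G.
Proof.
move=> hg hc Gn kc dc.
have [|A [A0 B0 bA]] := @edge_connectivity_boundary G; first by rewrite Gn; lia.
have {kc}bA := leq_trans bA kc.
have bB : (#|boundary (~: A)| <= c)%N by rewrite card_boundaryC.
(* With [x = #|X|], counting degrees gives [x * (c + 2 - x) <= c]. For [1 <= x <= c + 1] the left
   side is at least [c + 1], its value at both ends. *)
have ge2 (X : {set G}) : X != set0 -> (#|boundary X| <= c)%N -> (c + 2 <= #|X|)%N.
  rewrite -card_gt0 => X0 bX.
  have : (#|X| * c.+1 <= #|X| * #|X|.-1 + c)%N.
    rewrite -sum_nat_const; apply: leq_trans (leq_trans (sum_degree_boundary X) _).
      by apply: leq_sum => u _; exact: dc.
    by rewrite leq_add2l.
  by nia.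
have cA := ge2 A A0 bA; have cB := ge2 (~: A) B0 bB.
have nE : n = (#|A| + #|~: A|)%N by rewrite cardsC.
(* A vertex has at most [c] neighbours across the cut, while the opposite class has at least [c + 2]
   vertices. *)
have small (u : G) : (degree u <= n - 2)%N.
  have [uA|uB] := boolP (u \in A).
    by have := degree_le_boundary uA; lia.
  have /degree_le_boundary : u \in ~: A by rewrite inE.
  by lia.
have [v vmin] : exists v : G, forall u : G, (degree v <= degree u)%N.
  have /set0Pn[x _] := A0.
  have [v _ vmin] := @arg_minnP G x xpredT (@degree G) isT.
  by exists v => u; exact: vmin.
have -> : (n - c - 1)%:R = #|G|%:R - c%:R - 1 :> R.
  by rewrite Gn -subnDA natrB ?natrD ?opprD ?addrA//; lia.
have dpos (u : G) : (0 < degree u)%N by apply: leq_trans (dc u).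
(* Here [M = n - 2], [N = n - 1] and [k = c]; what remains is the case of exponent -1. *)
apply: (@sum_powR_gt R G (fun u => (degree u)%:R) v) => //.
- by rewrite ltr0n; lia.
- by rewrite ltr0n.
- by move=> u; rewrite !ler_nat vmin small.
- by rewrite ler_nat; lia.
rewrite Gn nE; apply: lt_le_trans (@inv_bound _ _ _ _ cA cB) _; first by lia.
rewrite [leRHS](bigID (mem A)) /= lerD//.
  by apply: sum_inv_degree => //; lia.
apply: le_trans (@sum_inv_degree G (~: A) c dpos _ bB) _; first by lia.
by under [leRHS]eq_bigl => u do rewrite -in_setC.
Qed.

End Bound.

Theorem theorem3p8 (R : realType) (n c : nat) (gamma : R) (G : sgraph)
    (hc : (1 <= c <= n - 1)%N) (hgamma : -1 <= gamma < 0)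
    (hconn : graph_connected G) (hn : graph_order G = n)
    (hkappa : (1 <= edge_connectivity G <= c)%N) :
  let bound : R := c%:R `^ gamma + (n - c - 1)%:R * (n - 2)%:R `^ gamma
                   + c%:R * (n - 1)%:R `^ gamma in
  bound <= zeroth_randic gamma G /\
  (zeroth_randic gamma G = bound <->
   graph_iso G (graph_join (complete_graph c)
                  (graph_union (complete_graph 1) (complete_graph (n - c - 1))))).
Proof.
move=> bound.
have iso_eq : graph_iso G (extremal_graph n c) -> zeroth_randic gamma G = bound.
  by move=> /zeroth_randic_iso ->; exact: zeroth_randic_extremal.
have /andP[_ gamma0] := hgamma; have /andP[_ kc] := hkappa.
have [/existsP[v vc]|/existsPn dc] := boolP [exists v : G, (degree v <= c)%N].
  have [le eq] := zeroth_randic_low_degree gamma0 hc hconn hn vc.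
  by split=> //; split=> [/eq|/iso_eq].
have lt : bound < zeroth_randic gamma G.
  by apply: zeroth_randic_high_degree => // u; rewrite ltnNge dc.
split; first exact: ltW.
by split=> [E|/iso_eq//]; rewrite E ltxx in lt.
Qed.
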